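(* Let $q$ be a fixed prime. Then there is a function $g:\mathbb{N}\to\mathbb{R}$ with $g(t)=o(t)$ as $t\to\infty$ such that for all $t$, \[ r(t; q+1) > 2^{t/2} q^{3t/8 + g(t)}. \] That is, $r(t;q+1) > 2^{t/2} q^{3t/8+o(t)}$.
   Context: For positive integers $t$ and $\ell$, the Ramsey number $r(t;\ell)$ is the smallest natural number $n$ such that every coloring of the edges of the complete graph $K_n$ with $\ell$ colors contains a monochromatic copy of $K_t$. The $o(t)$ term is as $t\to\infty$ with $q$ fixed. *)

(* Defs.v *)
From mathcomp Require Import all_boot.

Set Implicit Arguments.
Unset Strict Implicit.
Unset Printing Implicit Defensive.

Notation edge n := {e : {set 'I_n} | #|e| == 2}.

Definition mono_clique (n l t : nat) (c : {ffun edge n -> 'I_l})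
    (i : 'I_l) (A : {set 'I_n}) : bool :=
  (#|A| == t) && [forall e : edge n, (val e \subset A) ==> (c e == i)].

Definition ramsey_prop (t l n : nat) : bool :=
  [forall c : {ffun edge n -> 'I_l},
    [exists i : 'I_l, exists A : {set 'I_n}, mono_clique t c i A]].

(* Ramsey's theorem, by the neighbourhood argument on \sum_i k i, so that the
   Ramsey number below is a total function. *)
Lemma ramsey_offdiag (l : nat) (s : nat) (k : 'I_l -> nat) :
  (\sum_i k i <= s)%N ->
  exists N : nat, forall (V : finType) (c : V -> V -> 'I_l) (A : {set V}),
    (forall x y, c x y = c y x) -> (N.+1 <= #|A|)%N ->
    exists (i : 'I_l) (B : {set V}), [/\ B \subset A, #|B| = k i &
      {in B &, forall x y, x != y -> c x y = i}].
Proof.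
elim: s k => [|s IHs] k ks.
  exists 0 => V c A _ /card_gt0P[v _].
  exists (c v v), set0; split; [exact: sub0set | | by move=> x y; rewrite inE].
  move: ks; rewrite leqn0 sum_nat_eq0 => /forallP/(_ (c v v))/eqP ->.
  by rewrite cards0.
case: (pickP (fun i => k i == 0)) => [i /eqP ki0|k_gt0].
  exists 0 => V c A _ _; exists i, set0.
  by split; [exact: sub0set | rewrite ki0 cards0 | move=> x y; rewrite inE].
pose k' (i : 'I_l) := fun j => if j == i then (k j).-1 else k j.
have IH i : exists N : nat, forall (V : finType) (c : V -> V -> 'I_l)
    (A : {set V}), (forall x y, c x y = c y x) -> (N.+1 <= #|A|)%N ->
    exists (j : 'I_l) (B : {set V}), [/\ B \subset A, #|B| = k' i j &
      {in B &, forall x y, x != y -> c x y = j}].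
  apply: IHs; rewrite -ltnS; apply: leq_trans ks.
  rewrite (bigD1 i) //= [leqRHS](bigD1 i) //= /k' eqxx.
  rewrite (eq_bigr k) => [|j /negbTE -> //].
  by rewrite -addSn prednK // lt0n k_gt0.
have [N NP] : exists N : 'I_l -> nat, forall i, forall (V : finType)
    (c : V -> V -> 'I_l) (A : {set V}),
    (forall x y, c x y = c y x) -> ((N i).+1 <= #|A|)%N ->
    exists (j : 'I_l) (B : {set V}), [/\ B \subset A, #|B| = k' i j &
      {in B &, forall x y, x != y -> c x y = j}].
  exact: fin_all_exists IH.
exists (\sum_i (N i).+1) => V c A csym ltA.
have /card_gt0P[v vA] : (0 < #|A|)%N by exact: leq_ltn_trans ltA.
pose D i := [set x in A :\ v | c v x == i].
have [i Di] : exists i, ((N i).+1 <= #|D i|)%N.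
  apply/existsP; apply: contraTT ltA; rewrite negb_exists => /forallP ltD.
  rewrite -leqNgt (cardsD1 v) vA add1n.
  have -> : #|A :\ v| = \sum_i #|D i|.
    rewrite -sum1_card (partition_big (c v) xpredT) //=.
    by apply: eq_bigr => j _; rewrite -sum1_card; apply: eq_bigl => x; rewrite !inE.
  have -> : \sum_i (N i).+1 = \sum_i N i + l.
    under eq_bigr do rewrite -addn1.
    by rewrite big_split /= sum1_card card_ord.
  rewrite -addn1 leq_add //; last exact: leq_ltn_trans (ltn_ord (c v v)).
  by apply: leq_sum => j _; rewrite leqNgt ltD.
have [j [B [BD Bk Bc]]] := NP i V c (D i) csym Di.
have DA : D i \subset A by apply/subsetP => x; rewrite !inE => /andP[/andP[]].
move: Bk; rewrite /k'; case: eqVneq => [ji|_] Bk; last first.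
  by exists j, B; split=> //; exact: subset_trans DA.
subst j; exists i, (v |: B); split.
- by rewrite subUset sub1set vA (subset_trans BD).
- have vB : v \notin B.
    by apply/negP => /(subsetP BD); rewrite !inE eqxx.
  by rewrite cardsU1 vB Bk add1n prednK // lt0n k_gt0.
have cvB x : x \in B -> c v x = i.
  by move=> /(subsetP BD); rewrite !inE => /andP[_ /eqP].
move=> x y; rewrite !inE => /orP[/eqP->|xB] /orP[/eqP->|yB] xy.
- by rewrite eqxx in xy.
- exact: cvB.
- by rewrite csym cvB.
- exact: Bc.
Qed.

Lemma ramsey_exists (t l : nat) : exists n, ramsey_prop t l n.
Proof.
have [N NP] := @ramsey_offdiag l _ (fun=> t) (leqnn _).
exists N.+2; apply/forallP => c.
have e0P : #|[set ord0; ord_max] : {set 'I_N.+2}| == 2 by rewrite cards2.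
pose d := c (exist (fun e : {set 'I_N.+2} => #|e| == 2) _ e0P).
pose f (x y : 'I_N.+2) : 'I_l :=
  if insub [set x; y] is Some e then c e else d.
have fsym x y : f x y = f y x by rewrite /f setUC.
have [|i [B [_ Bt Bf]]] := NP _ f [set: 'I_N.+2] fsym.
  by rewrite cardsT card_ord ltnW.
apply/existsP; exists i; apply/existsP; exists B.
rewrite /mono_clique Bt eqxx /=; apply/forallP => e; apply/implyP => eB.
have /cards2P[x [y [xy exy]]] := valP e.
have xB : x \in B by apply: (subsetP eB); rewrite exy !inE eqxx.
have yB : y \in B by apply: (subsetP eB); rewrite exy !inE eqxx orbT.
by have := Bf x y xB yB xy; rewrite /f -exy valK => ->; rewrite eqxx.
Qed.

Definition ramsey (t l : nat) : nat := ex_minn (ramsey_exists t l).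

(* Main.v *)
(** After Conlon and Ferber.  Attach to every vertex of the complete graph an
    isotropic vector of the hyperbolic space of dimension [2m] over [F_q], where
    [2m] is just below [t], and give an edge the inner product of its endpoints
    as colour when that product is nonzero, and one of two further colours when
    it vanishes.  A clique in a nonzero colour [a] has Gram matrix [a(J - 1)], of
    corank at most one, hence fewer than [t] vertices.  A clique in one of the
    two further colours consists of pairwise orthogonal isotropic vectors, and
    there are only [q ^ (5 t ^ 2 / 8 + o(t ^ 2))] such [t]-tuples, as their span
    has dimension at most [m].  Choosing the vectors and the two further colours
    uniformly at random, a union bound over the [t]-subsets of the vertices
    shows that [n] vertices suffice only if
    [n ^ t >= 2 ^ (t ^ 2 / 2) q ^ (3 t ^ 2 / 8 - O(t))], so [g] can even be taken
    constant. *)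
Require Import Defs.
From mathcomp Require Import all_boot all_order all_algebra.
From mathcomp Require Import all_classical all_reals all_analysis.
From mathcomp Require Import fintype finset mxabelem.
From mathcomp Require Import zify ring lra.
Import Order.TTheory GRing.Theory Num.Theory numFieldNormedType.Exports.

Set Implicit Arguments.
Unset Strict Implicit.
Unset Printing Implicit Defensive.

Local Open Scope ring_scope.

(** * Counting functions and edge colourings *)

Lemma leq_bin_exp (n t : nat) : ('C(n, t) <= n ^ t)%N.
Proof.
elim: n t => [|n IHn] [|t] //; rewrite ?bin0 ?expn0 // binS.
apply: (@leq_trans (n ^ t.+1 + n ^ t)); first by rewrite leq_add.
by rewrite expnS -mulSnr expnS leq_mul2l; case: t => // t; rewrite leq_exp2r ?leqnSn.
Qed.

(** Overwriting the value at [i] injects each fibre into every other one, so all [#|W|] fibres have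
    the same size. *)
Lemma card_ffun_fiber (I W : finType) (P : pred {ffun I -> W}) (i : I) (w : W) :
    (forall f g : {ffun I -> W}, (forall j, j != i -> f j = g j) -> P f = P g) ->
  (#|[set f : {ffun I -> W} | (f i == w) && P f]| * #|W| = #|[set f | P f]|)%N.
Proof.
move=> Pi; pose S v := [set f : {ffun I -> W} | (f i == v) && P f].
have Sle v v' : (#|S v| <= #|S v'|)%N.
  pose upd (f : {ffun I -> W}) : {ffun I -> W} :=
    [ffun j => if j == i then v' else f j].
  rewrite -(@card_in_imset _ _ upd (mem (S v))); last first.
    move=> f g; rewrite !inE => /andP[/eqP fi _] /andP[/eqP gi _] /ffunP fg.
    apply/ffunP => j; case: (eqVneq j i) => [->|ji]; first by rewrite fi gi.
    by have := fg j; rewrite !ffunE (negPf ji).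
  apply/subset_leq_card/subsetP => _ /imsetP[f + ->].
  rewrite !inE ffunE !eqxx => /andP[_ Pf].
  by rewrite (Pi _ f) // => j ji; rewrite ffunE (negPf ji).
have Seq v : #|S v| = #|S w| by apply/eqP; rewrite eqn_leq !Sle.
rewrite -[RHS]sum1_card (partition_big (fun f : {ffun I -> W} => f i) xpredT) //=.
rewrite (eq_bigr (fun=> #|S w|)); first by rewrite sum_nat_const mulnC.
move=> v _; rewrite -(Seq v) -sum1_card; apply: eq_bigl => f.
by rewrite !inE andbC.
Qed.

(** Such an [h] is forced on the ['C(t, 2)] edges inside [A] and free on all others. *)
Lemma card_constant_on_edges (n t : nat) (A : {set 'I_n}) (b : bool) :
    #|A| = t ->
  (#|[set h : {ffun edge n -> bool} |
      [forall e : edge n, (val e \subset A) ==> (h e == b)]]| * 2 ^ 'C(t, 2)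
   = 2 ^ #|{: edge n}|)%N.
Proof.
move=> At; pose D := [set e : edge n | val e \subset A].
have -> : #|[set h : {ffun edge n -> bool} |
    [forall e : edge n, (val e \subset A) ==> (h e == b)]]|
    = #|pffun_on b (~: D) predT|.
  apply: eq_card => h; rewrite inE; apply/forallP/pffun_onP => [hA|[hD _] e].
    split=> //; apply/subsetP => e; rewrite !inE; apply: contra => eA.
    exact: implyP (hA e) eA.
  apply/implyP; apply: contraTT => hb.
  by have := subsetP hD e; rewrite !inE => ->.
rewrite card_pffun_on card_bool.
have <- : #|D| = 'C(t, 2).
  rewrite -At -cards_draws -(card_imset _ val_inj); apply: eq_card => e.
  rewrite !inE; apply/imsetP/andP => [[e' + ->]|[eA e2]].
    by rewrite inE; split=> //; exact: (valP e').
  by exists (exist _ e e2); rewrite ?inE.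
by rewrite -expnD addnC cardsC cardT.
Qed.

(** * Gram matrices and isotropic families *)

Lemma rank_near_constant_gram (F : fieldType) (s d : nat) (G : 'M[F]_(s, d))
    (M : 'M[F]_d) (a : F) : a != 0 ->
  G *m M *m G^T = \matrix_(i, j) (if i == j then 0 else a) -> (s <= d.+1)%N.
Proof.
move=> a0 GM.
(* The left side has full rank [s], while the all-[a] matrix has rank at most one, whatever the
   characteristic. *)
have aI : a%:M = (const_mx a : 'cV_s) *m (const_mx 1 : 'rV_s) - G *m M *m G^T.
  apply/matrixP => i j; rewrite GM !mxE big_ord1 !mxE.
  by case: (i == j); rewrite ?mulr1n ?mulr0n ?mulr1 ?subr0 ?subrr.
have <- : \rank (a%:M : 'M[F]_s) = s.
  by apply/eqP/row_freeP; exists a^-1%:M; rewrite -scalar_mxM divff.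
rewrite aI -(add1n d); apply: leq_trans (mxrank_add _ _) _; apply: leq_add.
  exact: leq_trans (mxrankM_maxr _ _) (rank_leq_row _).
by rewrite mxrank_opp -mulmxA (leq_trans (mxrankM_maxl _ _)) ?rank_leq_col.
Qed.

Section Isotropic.
Variables (F : finFieldType) (m : nat) (M : 'M[F]_(m + m)).
Hypotheses (Munit : M \in unitmx) (Msym : M^T = M).

(** This kernel is the orthogonal complement of the row space of [U]. *)
Lemma rank_orthogonal p (U : 'M[F]_(p, m + m)) :
  \rank (kermx (M *m U^T)) = (m + m - \rank U)%N.
Proof.
by rewrite mxrank_ker -mxrank_tr trmx_mul trmxK Msym mxrankMfree ?row_free_unit.
Qed.

Lemma isotropic_rank p (U : 'M[F]_(p, m + m)) : U *m M *m U^T = 0 -> (\rank U <= m)%N.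
Proof.
move=> Uiso.
have UK : (U <= kermx (M *m U^T))%MS by apply/sub_kermxP; rewrite mulmxA.
by have := mxrankS UK; rewrite rank_orthogonal; lia.
Qed.

(* [k * m + (m - r) + ... + 1]: in a chain of [k] isotropic extensions of a space
   of rank [r], a vector inside the span has at most [|F| ^ m] choices, while a
   vector that raises the rank from [j] has at most [|F| ^ (m + (m - j))].  The
   factor [2 ^ k] of [card_iso_on] accounts for which of the two occurs. *)
Definition iso_exp k r := (k * m + 'C((m - r).+1, 2))%N.

Lemma iso_exp_in k r : (r <= m -> r + iso_exp k r <= iso_exp k.+1 r)%N.
Proof. by rewrite /iso_exp mulSn -addnA => rm; rewrite leq_add2r. Qed.

(** Both sides agree: Pascal's rule peels off [m - r] when [r < m], and at [r = m] truncated
    subtraction makes both binomials vanish. *)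
Lemma iso_exp_out k r : (r <= m -> m + m - r + iso_exp k r.+1 <= iso_exp k.+1 r)%N.
Proof.
rewrite leq_eqVlt /iso_exp => /orP[/eqP->|rm].
  have -> : (m - m.+1 = 0)%N by lia.
  by rewrite subnn addnK mulSn; lia.
by rewrite subnSK // [in leqRHS]binS bin1 mulSn; lia.
Qed.

Lemma iso_exp_anti k r r' : (r <= r' -> iso_exp k r' <= iso_exp k r)%N.
Proof. by move=> rr; rewrite leq_add2l leq_bin2l // ltnS leq_sub2l. Qed.

Variables (W I : finType) (phi : W -> 'rV[F]_(m + m)).
Hypotheses (phi_inj : injective phi)
  (phi_iso : forall w, phi w *m M *m (phi w)^T = 0).

(** The rows of [U] stand for the vectors already chosen, so that an induction on [s] can adjoin one
    vector at a time. *)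
Definition iso_on p (U : 'M[F]_(p, m + m)) (s : seq I) (f : {ffun I -> W}) :=
  all (fun i => phi (f i) *m M *m U^T == 0) s &&
  all (fun i => all (fun j => phi (f i) *m M *m (phi (f j))^T == 0) s) s.

Lemma card_phi_sub p (U : 'M[F]_(p, m + m)) :
  (#|[set w | (phi w <= U)%MS]| <= #|F| ^ \rank U)%N.
Proof.
rewrite -card_rowg -(card_imset _ phi_inj); apply/subset_leq_card/subsetP => v.
by case/imsetP => w + ->; rewrite inE mem_rowg.
Qed.

Lemma iso_on_cons p (U : 'M[F]_(p, m + m)) i s f :
  iso_on U (i :: s) f ->
  (phi (f i) *m M *m U^T == 0) && iso_on (col_mx U (phi (f i))) s f.
Proof.
rewrite /iso_on /= => /andP[/andP[-> sU]] /andP[/andP[_ _] /allP ss] /=.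
apply/andP; split; apply/allP => j js; last first.
  by have /andP[] := ss j js.
rewrite tr_col_mx mul_mx_row (eqP (allP sU j js)).
by have /andP[/eqP-> _] := ss j js; rewrite row_mx0.
Qed.

(** Condition on the value [w] at the head of [s]. The constraint left on the tail is independent of
    that value, and induction bounds it with [phi w] appended to [U]; then sum over [w]. *)
Lemma card_iso_on (s : seq I) p (U : 'M[F]_(p, m + m)) :
    uniq s -> U *m M *m U^T = 0 ->
  (#|[set f : {ffun I -> W} | iso_on U s f]| * #|W| ^ size s
    <= 2 ^ size s * #|F| ^ iso_exp (size s) (\rank U) * #|{ffun I -> W}|)%N.
Proof.
elim: s p U => [|i s IHs] p U /=.
  move=> _ _; rewrite muln1 mul1n -[leqLHS]mul1n leq_mul ?max_card //.
  by rewrite expn_gt0 (cardD1 0) inE.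
case/andP=> nis us Uiso; set r := \rank U.
have rm : (r <= m)%N := isotropic_rank Uiso.
have F0 : (0 < #|F|)%N by rewrite (cardD1 0) inE.
pose P w f := iso_on (col_mx U (phi w)) s f.
pose orth w := phi w *m M *m U^T == 0.
have Piso w : orth w -> col_mx U (phi w) *m M *m (col_mx U (phi w))^T = 0.
  move=> /eqP wU; rewrite mul_col_mx tr_col_mx mul_col_row Uiso wU phi_iso.
  have -> : U *m M *m (phi w)^T = 0.
    by apply: trmx_inj; rewrite !trmx_mul trmxK Msym mulmxA wU trmx0.
  exact: block_mx_const.
have Pw w : (#|[set f : {ffun I -> W} | (f i == w) && P w f]| * #|W| =
             #|[set f | P w f]|)%N.
  apply: card_ffun_fiber => f g fg; rewrite /P /iso_on.
  have fgs j : j \in s -> f j = g j.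
    by move=> js; apply: fg; apply: contraNneq nis => <-.
  congr (_ && _); apply: eq_in_all => j js; rewrite fgs //.
  by apply: eq_in_all => j' js'; rewrite fgs.
have cover : (#|[set f : {ffun I -> W} | iso_on U (i :: s) f]| <=
    \sum_(w | orth w) #|[set f : {ffun I -> W} | (f i == w) && P w f]|)%N.
  rewrite -sum1_card (partition_big (fun f : {ffun I -> W} => f i) orth) /=.
    apply: leq_sum => w _; rewrite sum1_card; apply/subset_leq_card/subsetP => f.
    rewrite unfold_in /= !inE => /andP[/iso_on_cons/andP[_ h] /eqP fi].
    by rewrite -fi eqxx.
  by move=> f; rewrite inE => /iso_on_cons/andP[].
set k := size s; set N := #|{ffun I -> W}|.
have step w : orth w ->
    (#|[set f : {ffun I -> W} | (f i == w) && P w f]| * #|W| ^ k.+1 <=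
     2 ^ k * N * #|F| ^ iso_exp k (if (phi w <= U)%MS then r else r.+1))%N.
  move=> ow; rewrite expnS mulnA Pw; apply: leq_trans (IHs _ _ us (Piso w ow)) _.
  rewrite mulnAC leq_mul2l leq_pexp2l ?orbT // iso_exp_anti //.
  have Ucol : (U <= col_mx U (phi w))%MS /\ (phi w <= col_mx U (phi w))%MS.
    by apply/andP; rewrite -col_mx_sub submx_refl.
  case: ifP => wU; first by rewrite mxrankS // Ucol.1.
  by rewrite rank_ltmx // ltmxE Ucol.1 col_mx_sub submx_refl wU.
apply: leq_trans (leq_mul cover (leqnn _)) _; rewrite big_distrl /=.
apply: leq_trans (leq_sum _ step) _.
have -> : (2 ^ k.+1 * #|F| ^ iso_exp k.+1 r * N =
  2 ^ k * N * (#|F| ^ iso_exp k.+1 r + #|F| ^ iso_exp k.+1 r))%N.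
  by rewrite expnS; ring.
(* The [w] with [phi w] in the span of [U] use up one of the two equal summands, the remaining
   orthogonal ones the other. *)
rewrite -big_distrr /= leq_mul2l (bigID (fun w => (phi w <= U)%MS)) /=.
apply/orP; right; apply: leq_add.
  apply: (@leq_trans (\sum_(w in [set w | (phi w <= U)%MS]) #|F| ^ iso_exp k r)).
    rewrite big_mkcond [leqRHS]big_mkcond /=; apply: leq_sum => w _.
    by rewrite inE; case: (orth w); case: (phi w <= U)%MS.
  rewrite sum_nat_const; apply: leq_trans (leq_mul (card_phi_sub U) (leqnn _)) _.
  by rewrite -expnD leq_pexp2l // iso_exp_in.
apply: (@leq_trans (\sum_(w in [set w | (phi w <= kermx (M *m U^T))%MS])
    #|F| ^ iso_exp k r.+1)).
  rewrite big_mkcond [leqRHS]big_mkcond /=; apply: leq_sum => w _.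
  rewrite inE (sameP sub_kermxP eqP) mulmxA -/(orth w).
  by case: (orth w); case: (phi w <= U)%MS.
rewrite sum_nat_const; apply: leq_trans (leq_mul (card_phi_sub _) (leqnn _)) _.
by rewrite rank_orthogonal -expnD leq_pexp2l // iso_exp_out.
Qed.

End Isotropic.

Lemma leq_card_bigcup (I T : finType) (P : pred I) (S : I -> {set T}) :
  (#|\bigcup_(i | P i) S i| <= \sum_(i | P i) #|S i|)%N.
Proof.
elim/big_ind2: _ => [|s A s' B sA sB|//]; first by rewrite cards0.
exact: leq_trans (leq_card_setU _ _) (leq_add sA sB).
Qed.

(** * Hyperbolic space and its isotropic vectors *)

Section Hyperbolic.
Variables (F : fieldType) (k : nat).
Notation vec := 'rV[F]_((1 + k) + (1 + k)).

Definition hyperbolic : 'M[F]_((1 + k) + (1 + k)) := block_mx 0 1%:M 1%:M 0.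

(** The quadratic form whose polar form is [hyperbolic]; no division by 2 is involved. *)
Definition hyperbolic_quad (v : vec) : F := (lsubmx v *m (rsubmx v)^T) 0 0.

(* The coordinates [1] and [- x . y] make every pair [(x, y)] isotropic, so that
   uniform pairs give random isotropic vectors with no count of the quadric. *)
Definition isotropic_lift (w : 'rV[F]_k * 'rV[F]_k) : vec :=
  row_mx (row_mx 1 w.1) (row_mx (- (w.1 *m w.2^T)) w.2).

Lemma hyperbolic_sym : hyperbolic^T = hyperbolic.
Proof. by rewrite tr_block_mx !trmx0 !trmx1. Qed.

Lemma hyperbolic_unit : hyperbolic \in unitmx.
Proof.
apply: (proj1 (mulmx1_unit (B := hyperbolic) _)).
by rewrite mulmx_block !mulmx0 !mul0mx !mulmx1 !add0r !addr0 -scalar_mx_block.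
Qed.

Lemma hyperbolic_formE (u v : vec) :
  u *m hyperbolic *m v^T = lsubmx u *m (rsubmx v)^T + rsubmx u *m (lsubmx v)^T.
Proof.
rewrite -{1}(hsubmxK u) -{1}(hsubmxK v) mul_row_block tr_row_mx mul_row_col.
by rewrite !mulmx0 !mulmx1 add0r addr0 addrC.
Qed.

Lemma hyperbolic_quadD (u v : vec) :
  hyperbolic_quad (u + v) =
    hyperbolic_quad u + hyperbolic_quad v + (u *m hyperbolic *m v^T) 0 0.
Proof.
have rl : rsubmx u *m (lsubmx v)^T = (lsubmx v *m (rsubmx u)^T)^T.
  by rewrite trmx_mul trmxK.
rewrite /hyperbolic_quad hyperbolic_formE rl.
rewrite [lsubmx (u + v)]linearD [rsubmx (u + v)]linearD [(_ + _)^T]linearD /=.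
by rewrite mulmxDl !mulmxDr !mxE; ring.
Qed.

Lemma hyperbolic_quad_lift w : hyperbolic_quad (isotropic_lift w) = 0.
Proof.
rewrite /hyperbolic_quad row_mxKl row_mxKr tr_row_mx mul_row_col mul1mx.
by move: (w.1 *m _) => z; rewrite !mxE addNr.
Qed.

Lemma isotropic_lift_iso w : isotropic_lift w *m hyperbolic *m (isotropic_lift w)^T = 0.
Proof.
have rl : rsubmx (isotropic_lift w) *m (lsubmx (isotropic_lift w))^T =
    (lsubmx (isotropic_lift w) *m (rsubmx (isotropic_lift w))^T)^T.
  by rewrite trmx_mul trmxK.
have := hyperbolic_quad_lift w; rewrite hyperbolic_formE rl /hyperbolic_quad => q0.
by rewrite [_ *m _]mx11_scalar q0 raddf0 trmx0 addr0.
Qed.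

Lemma isotropic_lift_inj : injective isotropic_lift.
Proof. by case=> [x y] [x' y'] /eq_row_mx[/eq_row_mx[_ /= ->] /eq_row_mx[_ /= ->]]. Qed.

End Hyperbolic.

(** * The random colouring and the union bound *)

Section Colouring.
Variables (q k n : nat).
Hypothesis hq : prime q.
Local Notation W := ('rV['F_q]_k * 'rV['F_q]_k)%type.

(* By [hyperbolic_quadD] and isotropy this is the inner product of the two
   ends of [e], in a form symmetric in them and meaningful in characteristic 2. *)
Definition edge_product (f : {ffun 'I_n -> W}) (e : edge n) : 'F_q :=
  hyperbolic_quad (\sum_(x in val e) isotropic_lift (f x)).

(** Nonzero residues occupy the colours [1] to [q - 1], which leaves [0] and [q] for vanishing
    products. *)
Definition colouring (f : {ffun 'I_n -> W}) (h : {ffun edge n -> bool}) :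
    {ffun edge n -> 'I_q.+1} :=
  [ffun e => inord (if edge_product f e == 0 then (if h e then q else 0%N)
                    else edge_product f e)].

Lemma edge_productE f (e : edge n) x y : x != y -> val e = [set x; y] ->
  edge_product f e =
    (isotropic_lift (f x) *m hyperbolic _ _ *m (isotropic_lift (f y))^T) 0 0.
Proof.
move=> xy ex; rewrite /edge_product ex big_setU1 ?inE //= big_set1.
rewrite hyperbolic_quadD !hyperbolic_quad_lift.
by rewrite !add0r.
Qed.

Lemma ltn_Fp (v : 'F_q) : (v < q)%N.
Proof. by have := ltn_ord v; rewrite [X in (_ < X)%N]Fp_cast. Qed.

Lemma val_colouring f h e : colouring f h e =
  (if edge_product f e == 0 then (if h e then q else 0%N) else edge_product f e) :> nat.
Proof.
rewrite ffunE inordK // ltnS; case: ifP => _; last exact/ltnW/ltn_Fp.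
by case: ifP.
Qed.

Lemma mono_clique_colouring (t : nat) f h i (A : {set 'I_n}) :
    (k.*2 + 4 <= t)%N -> mono_clique t (colouring f h) i A ->
  #|A| = t /\ exists b : bool,
    iso_on (hyperbolic _ _) (@isotropic_lift _ k) (0 : 'M['F_q]_(0, _)) (enum A) f /\
    [forall e : edge n, (val e \subset A) ==> (h e == b)].
Proof.
move=> kt /andP[/eqP At /forallP Ai]; split=> //.
have {}Ai (e : edge n) : val e \subset A ->
    (if edge_product f e == 0 then (if h e then q else 0%N)
     else edge_product f e) = i :> nat.
  by move=> eA; rewrite -(val_colouring f h) (eqP (implyP (Ai e) eA)).
have mkedge x y : x \in A -> y \in A -> x != y ->
    exists2 e : edge n, val e = [set x; y] & val e \subset A.
  move=> xA yA xy; have e2 : #|[set x; y]| == 2 by rewrite cards2 xy.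
  exists (exist _ [set x; y] e2) => //=.
  by apply/subsetP => z; rewrite !inE => /orP[]/eqP->.
have q0 := prime_gt0 hq.
have [iq|] := boolP ((i == 0%N :> nat) || (i == q :> nat)).
  have A0 (e : edge n) : val e \subset A -> edge_product f e = 0 /\ h e = (i == q :> nat).
    move=> /Ai; have := ltn_Fp (edge_product f e).
    case: eqP => [-> _|e0 eq ei]; last first.
      case: e0; apply/val_inj => /=; move: iq; rewrite -ei (ltn_eqF eq) orbF.
      by move/eqP.
    by case: (h e) => <-; rewrite ?eqxx // ltn_eqF.
  exists (i == q :> nat); split; last first.
    by apply/forallP => e; apply/implyP => /A0[_ ->].
  apply/andP; split; apply/allP => x; rewrite mem_enum => xA.
    by rewrite trmx0 mulmx0.
  apply/allP => y; rewrite mem_enum => yA.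
  case: (eqVneq x y) => [->|xy]; first by rewrite isotropic_lift_iso.
  have [e ex /A0[]] := mkedge x y xA yA xy.
  by rewrite (edge_productE f xy ex) => z0 _; rewrite [X in X == _]mx11_scalar z0 raddf0.
rewrite negb_or => /andP[i0 iq].
have iltq : (i < q)%N by rewrite ltn_neqAle iq -ltnS ltn_ord.
have a0 : (i%:R : 'F_q) != 0.
  by rewrite -(dvdn_pcharf (pchar_Fp hq)) gtnNdvd // lt0n.
pose G := \matrix_(j < #|A|) isotropic_lift (f (enum_val j)).
(* The space has dimension [2k + 2], so a clique in a nonzero residue has at most [2k + 3 < t]
   vertices. *)
suff : (#|A| <= ((1 + k) + (1 + k)).+1)%N by rewrite At; lia.
apply: (rank_near_constant_gram (G := G) (M := hyperbolic _ _) a0).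
apply/matrixP => j l; rewrite [RHS]mxE.
have -> : (G *m hyperbolic _ _ *m G^T) j l =
    (isotropic_lift (f (enum_val j)) *m hyperbolic _ _ *m
     (isotropic_lift (f (enum_val l)))^T) 0 0.
  rewrite !mxE; apply: eq_bigr => r _; rewrite !mxE; congr (_ * _).
  by apply: eq_bigr => r' _; rewrite !mxE.
case: (eqVneq j l) => [->|jl]; first by rewrite isotropic_lift_iso mxE.
have xy : enum_val j != enum_val l by apply: contra_neq jl; exact: enum_val_inj.
have [e ex eA] := mkedge _ _ (enum_valP j) (enum_valP l) xy.
rewrite -(edge_productE f xy ex); have := Ai e eA; case: ifP => [_|_ <-].
  by move: i0 iq; case: (h e) => + + ei; rewrite -ei eqxx.
by rewrite natr_Zp.
Qed.

(** Union bound over [A] and the bit [b]: [2 ^ t] and the power of [q] on the right come from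
    [card_iso_on] with [m = k + 1] and rank 0, and the extra factor 2 from [b]. *)
Lemma ramsey_prop_count (t : nat) : (k.*2 + 4 <= t)%N -> ramsey_prop t q.+1 n ->
  (q ^ (k.*2 * t) * 2 ^ 'C(t, 2) <=
   n ^ t * 2 ^ t.+1 * q ^ (t * k.+1 + 'C(k.+2, 2)))%N.
Proof.
move=> kt /forallP ram.
pose X (A : {set 'I_n}) := [set f : {ffun 'I_n -> W} |
  iso_on (hyperbolic _ _) (@isotropic_lift _ k) (0 : 'M['F_q]_(0, _)) (enum A) f].
pose Y (A : {set 'I_n}) b := [set h : {ffun edge n -> bool} |
  [forall e : edge n, (val e \subset A) ==> (h e == b)]].
pose c := (2 ^ t * q ^ (t * k.+1 + 'C(k.+2, 2)))%N.
have cW : #|{: W}| = (q ^ k.*2)%N.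
  by rewrite card_prod !card_mx card_Fp // mul1n -expnD addnn.
have cover : (#|{: {ffun 'I_n -> W}}| * #|{: {ffun edge n -> bool}}| <=
    \sum_(A : {set 'I_n} | #|A| == t) \sum_(b : bool) #|X A| * #|Y A b|)%N.
  rewrite -card_prod -cardsT.
  apply: (@leq_trans #|\bigcup_(A : {set 'I_n} | #|A| == t)
      \bigcup_(b : bool) setX (X A) (Y A b)|).
    apply/subset_leq_card/subsetP => -[f h] _.
    have /existsP[i /existsP[A]] := ram (colouring f h).
    case/(mono_clique_colouring kt) => /eqP At [b [fA hA]].
    by apply/bigcupP; exists A => //; apply/bigcupP; exists b => //; rewrite !inE fA.
  apply: leq_trans (leq_card_bigcup _ _) (leq_sum _ _) => A _.
  apply: leq_trans (leq_card_bigcup _ _) (leq_sum _ _) => b _.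
  by rewrite cardsX.
have term (A : {set 'I_n}) (b : bool) : #|A| = t ->
  (#|X A| * #|Y A b| * (q ^ (k.*2 * t) * 2 ^ 'C(t, 2)) <=
   c * (#|{: {ffun 'I_n -> W}}| * #|{: {ffun edge n -> bool}}|))%N.
  move=> At.
  have hX : (#|X A| * q ^ (k.*2 * t) <= c * #|{: {ffun 'I_n -> W}}|)%N.
    pose U0 : 'M['F_q]_(0, (1 + k) + (1 + k)) := 0.
    have iso0 : U0 *m hyperbolic _ k *m U0^T = 0 by rewrite !mul0mx.
    have := card_iso_on (hyperbolic_unit _ _) (hyperbolic_sym _ _)
      (@isotropic_lift_inj _ k) (@isotropic_lift_iso _ k)
      (I := 'I_n) (W := W) (enum_uniq (mem A)) iso0.
    by rewrite cW -cardE At mxrank0 /iso_exp subn0 card_Fp // -expnM.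
  have hY : (#|Y A b| * 2 ^ 'C(t, 2) = #|{: {ffun edge n -> bool}}|)%N.
    by rewrite (card_constant_on_edges b At) card_ffun card_bool.
  by rewrite mulnACA [leqRHS]mulnA hY leq_mul.
set Om := (#|{: {ffun 'I_n -> W}}| * #|{: {ffun edge n -> bool}}|)%N in cover term *.
have Om0 : (0 < Om)%N.
  by rewrite muln_gt0 !card_ffun !expn_gt0 card_bool cW expn_gt0 prime_gt0.
rewrite -(leq_pmul2l Om0).
apply: leq_trans (leq_mul cover (leqnn _)) _; rewrite big_distrl /=.
apply: (@leq_trans (\sum_(A : {set 'I_n} | #|A| == t) 2 * (c * Om))).
  apply: leq_sum => A /eqP At; rewrite big_distrl /=.
  apply: leq_trans (leq_sum _ (fun b _ => term A b At)) _.
  by rewrite sum_nat_const card_bool.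
rewrite sum_nat_cond_const.
have -> : #|[set A : {set 'I_n} | #|A| == t]| = 'C(n, t).
  by rewrite card_draws card_ord.
apply: leq_trans (leq_mul (leq_bin_exp n t) (leqnn _)) _.
by rewrite /c expnS; apply/eq_leq; ring.
Qed.

End Colouring.

(** * From the count to the lower bound *)

Lemma ramsey_gt0 (t l : nat) : (0 < t)%N -> (0 < ramsey t l)%N.
Proof.
rewrite /ramsey; case: ex_minnP => -[|//] ram _ t0; move/forallP: ram.
have noedge (e : edge 0) : False.
  by case: e => e; rewrite (_ : e = finset.set0) ?cards0 //; apply/setP => -[].
move=> /(_ (finfun (fun e => False_rect _ (noedge e)))).
case/existsP => i /existsP[A /andP[/eqP At _]].
by move: t0; rewrite -At lt0n cards_eq0; case/set0Pn => -[].
Qed.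

Lemma natr_bin2 (R : numFieldType) (n : nat) :
  'C(n, 2)%:R = n%:R * (n%:R - 1) / 2 :> R.
Proof.
elim: n => [|n IHn]; first by rewrite bin0n mul0r mul0r.
by rewrite binS bin1 natrD IHn -[in RHS]natr1; field.
Qed.

Local Open Scope classical_set_scope.

Theorem theorem1 (R : realType) (q : nat) (hq : prime q) :
  exists g : nat -> R,
    g =o_\oo (fun t : nat => t%:R : R) /\
    forall t : nat, (0 < t)%N ->
      (ramsey t q.+1)%:R >
        (2 : R) `^ (t%:R / 2) * (q%:R : R) `^ (3 * t%:R / 8 + g t).
Proof.
(* The linear losses in the exponents, divided by [t], cost less than [q ^ 6]. *)
exists (fun=> -6); split.
  apply/eqoP => _/posnumP[e]; near=> t.
  rewrite /= normrN !ger0_norm // -ler_pdivrMl //.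
  near: t; exact: nbhs_infty_ger.
move=> t t0; have n0 := @ramsey_gt0 t q.+1 t0.
have q2 : (2 : R) <= q%:R by rewrite ler_nat prime_gt1.
have q0 : (0 : R) < q%:R by lra.
set a : R := ln 2; set b : R := ln q%:R.
have a0 : 0 < a by rewrite ln_gt0 //; lra.
have ab : a <= b by rewrite ler_ln // posrE; lra.
have nR0 : (0 : R) < (ramsey t q.+1)%:R by rewrite ltr0n.
rewrite -ltr_ln ?posrE // ?mulr_gt0 ?powR_gt0 //.
rewrite lnM ?posrE ?powR_gt0 // !ln_powR -/a -/b.
(* Here no [k] has [2k + 4 <= t], but the claimed bound is below 1. *)
have [t4|t4] := ltnP t 4.
  have n1 : (0 : R) <= ln (ramsey t q.+1)%:R by rewrite ln_ge0 // ler1n.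
  have t3 : t%:R <= 3 :> R by rewrite ler_nat.
  have t1 : 0 <= t%:R :> R by [].
  nra.
(* The largest [k] with [2k + 4 <= t]. *)
pose k := (t./2 - 2)%N.
have kt : (k.*2 + 4 <= t)%N by rewrite /k; lia.
have kt' : (t <= k.*2 + 5)%N by rewrite /k; lia.
have ram : ramsey_prop t q.+1 (ramsey t q.+1) by rewrite /ramsey; case: ex_minnP.
have := ramsey_prop_count hq kt ram; rewrite -(ler_nat R) !natrM !natrX.
set n := ramsey t q.+1 in n0 nR0 *.
rewrite -ler_ln ?posrE ?mulr_gt0 ?exprn_gt0 //.
rewrite !lnM ?posrE ?mulr_gt0 ?exprn_gt0 // !lnXn // -/a -/b.
set L := ln n%:R; rewrite -![a *+ _]mulr_natl -![b *+ _]mulr_natl -[L *+ _]mulr_natl.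
rewrite (natrD R (t * k.+1)) !natr_bin2.
rewrite -[k.+2]addn2 -[k.+1]addn1 -[t.+1]addn1 -muln2 !natrM !natrD.
move: kt kt'; rewrite -!(ler_nat R) -muln2 !natrD natrM.
have : 0 <= k%:R :> R by []; have : 4 <= t%:R :> R by rewrite ler_nat.
move: (t%:R) (k%:R) => x y x4 y0 yx xy H.
(* The count bounds [t * ln n], so the goal is multiplied by [t]. *)
rewrite -subr_gt0 -(pmulr_rgt0 _ (lt_le_trans (ltr0n _ 4) x4)).
(* The lost factor [2 ^ (3 t / 2 + 1)] is charged to [q], as [2 <= q]. *)
have h1 : 0 <= (b - a) * (3 / 2 * x + 1) by rewrite mulr_ge0 //; lra.
(* As [x - 5 <= 2 y <= x - 4], the second factor is at least [5 x / 4 - 1]. *)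
have h2 : 0 < b * (y * x + 5 * x - (y + 1) * (y + 2) / 2 -
                   3 * x ^+ 2 / 8 - 3 * x / 2 - 1).
  rewrite mulr_gt0 //; first lra.
  nra.
nra.
Unshelve. all: by end_near.
Qed.
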